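(* Let $\rho:\Gamma\to GL_p(\mathbb{C})$ be a representation with $\rho(T)=\mathrm{diag}(J_{m_1,\lambda_1},\dots,J_{m_t,\lambda_t})$, where $|\lambda_r|=1$ and $\lambda_r=e^{2\pi i\mu_r}$ with $\mu_r\in\mathbb{R}$. Let $\underline{\nu}\in\mathbb{Z}^t$. Then there is $K$ such that for all $\underline{k}=(k_1,\dots,k_p)\in\mathbb{Z}^p$ with $\min_i k_i\ge K$, the series defining $P_{\underline{k}}(\underline{\nu},\tau)$ converges absolutely and uniformly (entrywise) on $\mathcal{S}=\{\tau\in\mathfrak{H}:|\mathrm{Re}\,\tau|\le1/2,\ \mathrm{Im}\,\tau\ge\sqrt3/2\}$.
   Context: $\Gamma=SL_2(\mathbb{Z})$ acts on the upper half-plane $\mathfrak{H}$ by Möbius transformations; $T=\begin{pmatrix}1&1\\0&1\end{pmatrix}$. $\binom{x}{t}=x(x-1)\cdots(x-t+1)/t!$, $\binom{x}{0}=1$, $\binom{x}{t}=0$ for $t<0$. $J_{m,\lambda}$ is the $m\times m$ matrix with $\lambda$ on the diagonal and subdiagonal and $0$ elsewhere; $m_1+\dots+m_t=p$. $B_m(x)$ is the $m\times m$ matrix with $(i,j)$ entry $(-1)^{i-j}\binom{x+i-j-1}{i-j}$; its inverse has $(i,j)$ entry $\binom{x}{i-j}$. $B_\rho(x)=\mathrm{diag}(B_{m_1}(x),\dots,B_{m_t}(x))$, $\Lambda_\rho(z_1,\dots,z_t)=\mathrm{diag}(z_1I_{m_1},\dots,z_tI_{m_t})$, $J_{\underline{k}}(\gamma,\tau)=\mathrm{diag}((c\tau+d)^{k_1},\dots,(c\tau+d)^{k_p})$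 for $\gamma=\begin{pmatrix}a&b\\c&d\end{pmatrix}$. $P_{\underline{k}}(\underline{\nu},\tau)=\frac12\sum_M\rho(M)^{-1}\Lambda_\rho(e^{2\pi i(\nu_1+\mu_1)M\tau},\dots,e^{2\pi i(\nu_t+\mu_t)M\tau})B_\rho(M\tau)^{-1}J_{\underline{k}}(M,\tau)^{-1}$, $M$ running over a set of representatives of the right cosets $\langle T\rangle\backslash\Gamma$ (each summand depends only on the coset of $M$). *)

(* Defs.v *)
From HB Require Import structures.
From mathcomp Require Import all_boot all_order all_algebra.
From mathcomp Require Import finmap complex.
From mathcomp Require Import all_classical all_reals all_analysis.
(* [summability] is not imported: its [summable] and [sum] would shadow
   [esum.summable]. *)
From mathcomp Require summability.
Set Implicit Arguments.
Unset Strict Implicit.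
Unset Printing Implicit Defensive.
Import Order.TTheory GRing.Theory Num.Theory.
Import numFieldNormedType.Exports.
Local Open Scope classical_set_scope.
Local Open Scope complex_scope.
Local Open Scope ring_scope.

Record SL2Z := MkSL2Z { sl2_mx :> 'M[int]_2; _ : \det sl2_mx == 1 }.

HB.instance Definition _ := [isSub for sl2_mx].
HB.instance Definition _ := [Choice of SL2Z by <:].

Lemma sl2_det (M : SL2Z) : \det M = 1.
Proof. by case: M => ? /= /eqP. Qed.

Lemma sl2_unit (M : SL2Z) : sl2_mx M \in unitmx.
Proof. by rewrite unitmxE sl2_det unitr1. Qed.

Fact sl2_one_det : \det (1%:M : 'M[int]_2) == 1.
Proof. by rewrite det1. Qed.

Fact sl2_mul_det (M N : SL2Z) : \det (sl2_mx M *m sl2_mx N) == 1.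
Proof. by rewrite det_mulmx !sl2_det mulr1. Qed.

Fact sl2_inv_det (M : SL2Z) : \det (invmx (sl2_mx M)) == 1.
Proof. by rewrite det_inv sl2_det invr1. Qed.

Definition sl2_one := MkSL2Z sl2_one_det.
Definition sl2_mul (M N : SL2Z) := MkSL2Z (sl2_mul_det M N).
Definition sl2_inv (M : SL2Z) := MkSL2Z (sl2_inv_det M).

Fact sl2_mulA : associative sl2_mul.
Proof. by move=> M N P; apply/val_inj/mulmxA. Qed.

Fact sl2_mul1 : left_id sl2_one sl2_mul.
Proof. by move=> M; apply/val_inj/mul1mx. Qed.

Fact sl2_mulr1 : right_id sl2_one sl2_mul.
Proof. by move=> M; apply/val_inj/mulmx1. Qed.

Fact sl2_mulV : left_inverse sl2_one sl2_inv sl2_mul.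
Proof. by move=> M; apply/val_inj/mulVmx/sl2_unit. Qed.

Fact sl2_mulrV : right_inverse sl2_one sl2_inv sl2_mul.
Proof. by move=> M; apply/val_inj/mulmxV/sl2_unit. Qed.

HB.instance Definition _ :=
  isGroup.Build SL2Z sl2_mulA sl2_mul1 sl2_mulr1 sl2_mulV sl2_mulrV.

Fact sl2_T_det : \det (\matrix_(i < 2, j < 2) (i <= j)%N%:R : 'M[int]_2) == 1.
Proof.
rewrite -det_tr det_trig; first by rewrite !big_ord_recl big_ord0 !mxE.
by apply/is_trig_mxP => i j ltij; rewrite !mxE leqNgt ltij.
Qed.

Definition sl2_T := MkSL2Z sl2_T_det.

Definition cyclic_T : set SL2Z :=
  [set M | exists n : nat, M = (sl2_T ^+ n)%g \/ M = (sl2_T ^- n)%g].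

(* Exactly one element in each coset <T>M. *)
Definition coset_reps (Rep : set SL2Z) : Prop :=
  forall M : SL2Z, exists! N : SL2Z, Rep N /\ cyclic_T (M * N^-1)%g.

(* Invertibility of each [rho M] follows from the two conditions. *)
Definition is_representation (F : fieldType) (p : nat) (rho : SL2Z -> 'M[F]_p)
    : Prop :=
  rho 1%g = 1%:M /\ forall M N : SL2Z, rho (M * N)%g = rho M *m rho N.

Section Poincare.
Variable R : realType.
Local Notation C := (R[i]).

Definition cexp (z : C) : C :=
  (expR (complex.Re z) * cos (complex.Im z))
    +i* (expR (complex.Re z) * sin (complex.Im z)).

(* e^(2 pi i z) *)
Definition cexp2pi (z : C) : C := cexp ((0 +i* (2 * pi)) * z).

Definition automorphy (M : SL2Z) (tau : C) : C :=
  (M 1 0)%:~R * tau + (M 1 1)%:~R.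

Definition mobius (M : SL2Z) (tau : C) : C :=
  ((M 0 0)%:~R * tau + (M 0 1)%:~R) / automorphy M tau.

Definition cbinom (x : C) (t : int) : C :=
  if t is Posz n then (\prod_(l < n) (x - l%:R)) / (n`!)%:R else 0.

Definition jordan (m : nat) (lambda : C) : 'M[C]_m :=
  \matrix_(i, j) (if (i == j) || (i == j.+1 :> nat) then lambda else 0).

Definition Bmx (m : nat) (x : C) : 'M[C]_m :=
  \matrix_(i, j) let d := (i%:Z - j%:Z)%R in
    (-1) ^ d * cbinom (x + d%:~R - 1) d.

Section Blocks.
Variables (t : nat) (m : 'I_t -> nat).
Local Notation p := (\sum_r m r)%N.

Definition jordan_diag (lambda : 'I_t -> C) : 'M[C]_p :=
  \mxdiag_r jordan (m r) (lambda r).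

Definition Brho (x : C) : 'M[C]_p := \mxdiag_r Bmx (m r) x.

Definition Lambda_rho (z : 'I_t -> C) : 'M[C]_p := \mxdiag_r (z r)%:M.

Definition Jk (k : 'I_p -> int) (M : SL2Z) (tau : C) : 'M[C]_p :=
  diag_mx (\row_i automorphy M tau ^ k i).

Variables (rho : SL2Z -> 'M[C]_p) (mu : 'I_t -> R) (nu : 'I_t -> int).
Variable k : 'I_p -> int.

Definition poincare_term (M : SL2Z) (tau : C) : 'M[C]_p :=
  invmx (rho M)
    *m Lambda_rho (fun r => cexp2pi (((nu r)%:~R + mu r)%:C * mobius M tau))
    *m invmx (Brho (mobius M tau))
    *m invmx (Jk k M tau).

Variable Rep : set SL2Z.

Definition poincare_partial (F : {fset Rep}) (tau : C) : 'M[C]_p :=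
  2^-1 *: \sum_(M <- F) poincare_term (set_val M) tau.

(* The sum over [Rep] is the limit of the finite partial sums along the filter
   [totally] of finite subsets of [Rep] ordered by inclusion.  The regular
   module [C^o] is the copy of [C] that carries the norm topology. *)
Definition poincare (tau : C) : 'M[C]_p :=
  \matrix_(i, j)
    lim ((fun F => poincare_partial F tau i j : C^o) @ summability.totally).

End Blocks.

Definition fund_strip : set C :=
  [set tau : C | [/\ 0 < complex.Im tau, `|complex.Re tau| <= 2^-1
                   & Num.sqrt 3 / 2 <= complex.Im tau]].

End Poincare.

Arguments fund_strip R : clear implicits.

(* Main.v *)
(* The summands depend only on the coset of [M], because the matrix
   [E x = Lambda_rho (e^(2 pi i (nu + mu) x)) Brho(x)^-1] satisfies
   [E (x + 1) = rho T E x] (Pascal's rule).  For [nu = 0] this also gives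
   [rho (T ^ n) = E n], which is polynomially bounded in [n], and Euclid's
   algorithm on the first column, with remainders halved at each step, turns it
   into a polynomial bound for [rho] on [Gamma]: logarithmically many steps
   multiply the constant factors to a power of [|c|], while the product of the
   partial quotients telescopes.  Choosing in each coset with [c <> 0] the
   representative with [2 |a| <= |c|] keeps [M tau] in a fixed disc, and
   [|c tau + d| >= (|c| + |d|) / 2] on the strip, so for large weights the terms
   are dominated by a multiple of [(1 + |c|)^-2 (1 + |d|)^-2].  The two cosets
   with [c = 0] may be unbounded on the strip, but they do not matter for the
   tails of the series. *)
Require Import Defs.
From mathcomp Require Import all_boot all_order all_algebra.
From mathcomp Require Import finmap complex.
From mathcomp Require Import all_classical all_reals all_analysis.
From mathcomp Require summability.
From mathcomp Require Import zify ring lra.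
Set Implicit Arguments.
Unset Strict Implicit.
Unset Printing Implicit Defensive.
Import Order.TTheory GRing.Theory Num.Theory.
Import numFieldNormedType.Exports.
Local Open Scope classical_set_scope.
Local Open Scope complex_scope.
Local Open Scope ring_scope.
Local Notation normc := Normc.normc.

(** * The real-valued modulus on [R[i]] *)

Section Normc.
Variable R : realType.
Implicit Types z w : R[i].

Lemma normc_ge0 z : 0 <= normc z.
Proof. by case: z => a b; exact: sqrtr_ge0. Qed.

Lemma normCE z : `|z| = (normc z)%:C.
Proof. by case: z. Qed.

Lemma ler_normcD z w : normc (z + w) <= normc z + normc w.
Proof. exact: le_normcD. Qed.

Lemma ler_normc_sum (I : Type) (s : seq I) (P : pred I) (h : I -> R[i]) :
  normc (\sum_(x <- s | P x) h x) <= \sum_(x <- s | P x) normc (h x).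
Proof.
elim/big_rec2: _ => [|x y1 y2 _ le12]; first by rewrite Normc.normc0.
by apply: le_trans (ler_normcD _ _) _; rewrite lerD2l.
Qed.

Lemma normcX z n : normc (z ^+ n) = normc z ^+ n.
Proof.
by elim: n => [|n IH]; rewrite ?Normc.normc1 // !exprS Normc.normcM IH.
Qed.

Lemma normc_real (x : R) : normc x%:C = `|x|.
Proof. by rewrite /= expr0n addr0 sqrtr_sqr. Qed.

Lemma ler_Re_normc z : `|complex.Re z| <= normc z.
Proof. by case: z => a b /=; rewrite -sqrtr_sqr ler_wsqrtr // lerDl sqr_ge0.
  Qed.

Lemma ler_Im_normc z : `|complex.Im z| <= normc z.
Proof. by case: z => a b /=; rewrite -sqrtr_sqr ler_wsqrtr // lerDr sqr_ge0.
  Qed.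

Lemma ler_normc_ReIm z : normc z <= `|complex.Re z| + `|complex.Im z|.
Proof.
case: z => a b /=; rewrite -[X in _ <= X]ger0_norm ?addr_ge0 // -sqrtr_sqr.
apply: ler_wsqrtr; rewrite sqrrD !real_normK ?num_real // lerD2r lerDl.
by rewrite mulrn_wge0 // mulr_ge0.
Qed.

End Normc.

(* A Weierstrass M-test for sums along the finite subsets of an index set *)
#[local] Existing Instance summability.totally_filter.

Section MTest.
Variables (R : realType) (J T : choiceType) (S : set T).
Variables (f : J -> T -> R[i]) (w : J -> R) (W : R).
Hypothesis w_ge0 : forall x, 0 <= w x.
Hypothesis w_bounded : forall F : {fset J}, \sum_(x <- F) w x <= W.
Hypothesis f_pointwise :
  forall y, S y -> exists c, forall x, normc (f x y) <= c * w x.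
(* Only the terms of small weight are dominated uniformly: the finitely many
   others may be unbounded on [S]. *)
Hypothesis f_uniform : exists c d, 0 < d /\
  forall x y, S y -> w x < d -> normc (f x y) <= c * w x.

Local Notation psum F y := (\sum_(x <- F) f x y).

Lemma big_fset_sub (V : zmodType) (h : J -> V) (F G : {fset J}) :
  (F `<=` G)%fset ->
  \sum_(x <- G) h x = \sum_(x <- F) h x + \sum_(x <- (G `\` F)%fset) h x.
Proof.
move=> FG; rewrite (big_fsetID _ (mem F) G) /=; congr (_ + _).
  apply: congr_big => //; congr enum_fset; apply/fsetP => x.
  by rewrite !inE /= andbC; case: (boolP (x \in F)) => //= /(fsubsetP FG).
apply: congr_big => //; congr enum_fset; apply/fsetP => x.
by rewrite !inE /= andbC.
Qed.

(** Pick [F0] whose sum is within [e] of the supremum of all finite sums; the sum over [G] cannot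
    exceed that supremum. *)
Lemma weight_tail (e : R) : 0 < e -> exists F0 : {fset J},
  forall F G : {fset J}, (F0 `<=` F)%fset -> (F `<=` G)%fset ->
  \sum_(x <- (G `\` F)%fset) w x < e.
Proof.
move=> e_gt0; pose E := [set \sum_(x <- F) w x | F in [set: {fset J}]].
have E_sup : has_sup E.
  by split; [exists (\sum_(x <- fset0) w x), fset0|exists W => _ [F _ <-]].
have [_ [F0 _ <-] ltF0] := sup_adherent e_gt0 E_sup.
exists F0 => F G F0F FG.
have leG : \sum_(x <- G) w x <= sup E by apply: ub_le_sup;
  [case: E_sup|exists G].
have := big_fset_sub w FG; have := big_fset_sub w F0F.
have : 0 <= \sum_(x <- (F `\` F0)%fset) w x by apply: sumr_ge0.
lra.
Qed.

Lemma psum_tail_pointwise y (e : R) : S y -> 0 < e -> exists F0 : {fset J},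
  forall F G : {fset J}, (F0 `<=` F)%fset -> (F `<=` G)%fset ->
  normc (psum G y - psum F y) < e.
Proof.
move=> Sy e_gt0; have [c fc] := f_pointwise Sy.
have c1_gt0 : 0 < `|c| + 1 by rewrite ltr_wpDl.
have [F0 tailF0] := weight_tail (divr_gt0 e_gt0 c1_gt0).
exists F0 => F G F0F FG; rewrite (big_fset_sub _ FG) addrC addKr.
apply: le_lt_trans (ler_normc_sum _ _ _) _.
apply: (@le_lt_trans _ _ ((`|c| + 1) * \sum_(x <- (G `\` F)%fset) w x)).
  rewrite mulr_sumr; apply: ler_sum => x _; apply: le_trans (fc x) _.
  by rewrite ler_wpM2r // ler_wpDr // ler_norm.
by rewrite mulrC -ltr_pdivlMr // tailF0.
Qed.

Lemma psum_tail_uniform (e : R) : 0 < e -> exists F0 : {fset J},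
  forall F G : {fset J}, (F0 `<=` F)%fset -> (F `<=` G)%fset ->
  forall y, S y -> normc (psum G y - psum F y) < e.
Proof.
move=> e_gt0; have [c [d [d_gt0 fcd]]] := f_uniform.
have c1_gt0 : 0 < `|c| + 1 by rewrite ltr_wpDl.
(* A tail of total weight below [d] has only indices of weight below [d], so the uniform domination
   applies to all of its terms; the other bound makes the tail smaller than [e]. *)
have e'_gt0 : 0 < Num.min d (e / (`|c| + 1)).
  by rewrite lt_min d_gt0 divr_gt0.
have [F0 tailF0] := weight_tail e'_gt0.
exists F0 => F G F0F FG y Sy; rewrite (big_fset_sub _ FG) addrC addKr.
have := tailF0 F G F0F FG; rewrite lt_min => /andP[lt_d lt_e].
apply: le_lt_trans (ler_normc_sum _ _ _) _.
apply: (@le_lt_trans _ _ ((`|c| + 1) * \sum_(x <- (G `\` F)%fset) w x)).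
  rewrite mulr_sumr big_seq [X in _ <= X]big_seq.
  apply: ler_sum => x xGF; apply: le_trans (fcd x y Sy _) _.
    apply: le_lt_trans lt_d; rewrite (big_fsetD1 x) //= lerDl.
    exact: sumr_ge0.
  by rewrite ler_wpM2r // ler_wpDr // ler_norm.
by rewrite mulrC -ltr_pdivlMr.
Qed.

(** Completeness is used over [R], for real and imaginary parts separately; the limit in [R[i]] is
    assembled from the two. *)
Lemma cvg_totally_real (g : {fset J} -> R) :
  (forall e, 0 < e -> exists F0 : {fset J},
    forall F, (F0 `<=` F)%fset -> `|g F - g F0| < e) ->
  cvg (g @ summability.totally).
Proof.
move=> g_cauchy; apply/cauchy_cvgP/cauchy_exP => e e_gt0.
have [F0 gF0] := g_cauchy e e_gt0.
exists (g F0), F0 => // F F0F; rewrite /= /ball /= distrC.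
exact: gF0.
Qed.

Lemma psum_cvg y : S y -> exists l : R[i],
  (fun F : {fset J} => psum F y : (R[i])^o) @ summability.totally --> (l :
    (R[i])^o).
Proof.
move=> Sy.
have cvRe : cvg ((fun F : {fset J} => complex.Re (psum F y)) @
  summability.totally).
  apply: cvg_totally_real => e e_gt0.
  have [F0 tailF0] := psum_tail_pointwise Sy e_gt0; exists F0 => F F0F.
  apply: le_lt_trans (tailF0 F0 F (fsubset_refl _) F0F).
  by apply: le_trans (ler_Re_normc _); rewrite raddfB.
have cvIm : cvg ((fun F : {fset J} => complex.Im (psum F y)) @
  summability.totally).
  apply: cvg_totally_real => e e_gt0.
  have [F0 tailF0] := psum_tail_pointwise Sy e_gt0; exists F0 => F F0F.
  apply: le_lt_trans (tailF0 F0 F (fsubset_refl _) F0F).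
  by apply: le_trans (ler_Im_normc _); rewrite raddfB.
set a := lim _ in cvRe; set b := lim _ in cvIm.
exists (a +i* b); apply/cvgrPdist_lt => -[e e'].
(* In the order of [R[i]], a positive number is real. *)
rewrite ltcE /= => /andP[/eqP -> e_gt0].
have e2_gt0 : 0 < e / 2 by rewrite divr_gt0.
have /cvgrPdist_lt /(_ _ e2_gt0) nearRe := cvRe.
have /cvgrPdist_lt /(_ _ e2_gt0) nearIm := cvIm.
near=> F; rewrite normCE ltcR.
apply: le_lt_trans (ler_normc_ReIm _) _; rewrite [e]splitr !raddfB /=.
by apply: ltrD; [near: F|near: F].
Unshelve. all: by end_near. Qed.

Lemma Mtest_uniform :
  {uniform S, (fun (F : {fset J}) (y : T) => psum F y : (R[i])^o)
      @ summability.totally -->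
    (fun y => lim ((fun F : {fset J} => psum F y : (R[i])^o)
      @ summability.totally))}.
Proof.
move=> P /uniform_nbhs[E [entE EP]].
move: entE; rewrite -entourage_from_ballE => -[[e e']].
rewrite /= ltcE /= => /andP[/eqP -> e_gt0] ballE.
have e2_gt0 : 0 < e / 2 by rewrite divr_gt0.
have [F0 tailF0] := psum_tail_uniform e2_gt0.
exists F0 => // F /= F0F; apply: EP => y Sy; apply: ballE => /=.
have [l cvl] := psum_cvg Sy.
have -> : lim ((fun F : {fset J} => psum F y : (R[i])^o) @ summability.totally)
    = l by apply: (cvg_lim _ cvl); exact: norm_hausdorff.
have e2C : 0 < (e / 2)%:C by rewrite ltcR.
(* [F1] depends on [y], but only serves to compare the sum over [F] with the limit through the union
   of both; [F0] does not depend on [y]. *)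
have /cvgrPdist_lt /(_ _ e2C) [F1 _ nearF1] := cvl.
have := nearF1 (F `|` F1)%fset (fsubsetUr _ _).
have := tailF0 F (F `|` F1)%fset F0F (fsubsetUl _ _) y Sy.
rewrite /ball /= !normCE !ltcR => lt1 lt2.
rewrite -(subrK (psum (F `|` F1)%fset y) l) -addrA [e]splitr.
by apply: le_lt_trans (ler_normcD _ _) _; apply: ltrD.
Qed.

End MTest.

(** * Summable weights on pairs of integers *)

Section Weights.
Variable R : realType.

Lemma summable_bounded (I : choiceType) (A : set I) (a : I -> R) (W : R) :
  (forall s, uniq s -> (forall x, x \in s -> A x) ->
     \sum_(x <- s) `|a x| <= W) ->
  summable A (fun x => (a x)%:E).
Proof.
move=> sW; rewrite /summable /esum; apply: (@le_lt_trans _ _ W%:E);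
  last exact: ltry.
apply: ge_ereal_sup => _ [F [finF FA] <-].
rewrite fsbig_finite //= sumEFin lee_fin; apply: sW; first exact: fset_uniq.
by move=> x; rewrite in_fset_set // inE => /FA.
Qed.

Lemma ler_sum_subseq (I : eqType) (s s' : seq I) (h : I -> R) :
  (forall x, 0 <= h x) -> uniq s -> uniq s' -> {subset s <= s'} ->
  \sum_(x <- s) h x <= \sum_(x <- s') h x.
Proof.
move=> h_ge0 us us' ss'.
rewrite (perm_big _ (_ : perm_eq s [seq x <- s' | x \in s])) /=.
  rewrite big_filter big_mkcond /=; apply: ler_sum => x _.
  by case: ifP.
apply: uniq_perm => //; first exact: filter_uniq.
move=> x; rewrite mem_filter; case: (boolP (x \in s)) => //= /ss' ->.
by [].
Qed.

Definition int_weight (c : int) : R := (1 + `|c|%N%:R) ^- 2.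

Lemma int_weight_ge0 c : 0 <= int_weight c.
Proof. by rewrite /int_weight invr_ge0 exprn_ge0 // addr_ge0. Qed.

Lemma sum_inv_sqr_le N : \sum_(n <- iota 0 N) (1 + n%:R : R) ^- 2 <= 2.
Proof.
(* The sharper bound is what induction can carry: its increments telescope and dominate the inverse
   squares. *)
suff H : \sum_(n <- iota 0 N) (1 + n%:R : R) ^- 2 <= 2 - 2 / (1 + N%:R).
  by apply: le_trans H _; rewrite gerBl divr_ge0 // addr_ge0.
elim: N => [|N IH]; first by rewrite big_nil addr0 divr1 subrr.
rewrite -addn1 iotaD big_cat /= big_seq1 add0n.
have N0 : (0 : R) <= N%:R by [].
apply: le_trans (lerD IH (lexx _)) _.
rewrite addn1 -[N.+1%:R]natr1; move: (N%:R) N0 => x x0.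
rewrite -subr_ge0.
have -> : 2 - 2 / (1 + (x + 1)) - (2 - 2 / (1 + x) + (1 + x) ^- 2) =
  x / ((1 + x) ^+ 2 * (2 + x)).
  by field; rewrite !lt0r_neq0 //; lra.
by apply: divr_ge0 => //; apply: mulr_ge0; [exact: sqr_ge0|lra].
Qed.

Lemma sum_int_weight_le N :
  \sum_(c <- [seq Posz n | n <- iota 0 N] ++ [seq Negz n | n <- iota 0 N])
    int_weight c <= 4.
Proof.
rewrite big_cat !big_map /= (_ : 4 = 2 + 2 :> R); last by ring.
apply: lerD; first exact: sum_inv_sqr_le.
(* [Negz n] is [-(n + 1)], so its weight is at most that of [n]. *)
apply: le_trans (sum_inv_sqr_le N); apply: ler_sum => n _.
rewrite /int_weight /= lef_pV2 ?posrE ?exprn_gt0 ?ltr_wpDr //.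
by rewrite lerXn2r ?nnegrE ?addr_ge0 // lerD2l ler_nat.
Qed.

(** A finite set of pairs lies in a square, over which the sum factors into two sums of at most
    4. *)
Lemma sum_pair_weight_le (s : seq (int * int)) : uniq s ->
  \sum_(cd <- s) int_weight cd.1 * int_weight cd.2 <= 16.
Proof.
move=> us.
have [N ltN] : exists N, forall cd, cd \in s ->
  (`|cd.1| < N)%N && (`|cd.2| < N)%N.
  exists (\max_(cd <- s) maxn `|cd.1| `|cd.2|).+1%N => cd cds.
  rewrite !ltnS -geq_max.
  exact: (@leq_bigmax_seq _ s predT (fun cd => maxn `|cd.1| `|cd.2|) cd cds
    isT).
pose L := [seq Posz n | n <- iota 0 N] ++ [seq Negz n | n <- iota 0 N].
have uL : uniq L.
  rewrite cat_uniq !map_inj_uniq ?iota_uniq ?andbT; try by move=> ? ? [].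
  by apply/hasPn => _ /mapP[n _ ->]; apply/mapP => -[].
have mL (c : int) : (`|c| < N)%N -> c \in L.
  rewrite mem_cat; case: c => n /= nN; apply/orP; [left|right];
    by apply: map_f; rewrite mem_iota //=; lia.
pose P := [seq (c, d) | c <- L, d <- L].
apply: (@le_trans _ _ (\sum_(cd <- P) int_weight cd.1 * int_weight cd.2)).
  apply: ler_sum_subseq => //.
  - by move=> x; rewrite mulr_ge0 // int_weight_ge0.
  - by apply: allpairs_uniq => // -[? ?] [? ?].
  move=> [c d] /ltN /= /andP[ltc ltd]; apply: allpairs_f; exact: mL.
rewrite big_allpairs /=.
under eq_bigr do rewrite -mulr_sumr.
rewrite -mulr_suml (_ : 16 = 4 * 4 :> R); last by ring.
by apply: ler_pM; rewrite ?sum_int_weight_le ?sumr_ge0 // => c _;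
  exact: int_weight_ge0.
Qed.

End Weights.

(** * Polynomially bounded functions and matrices *)

Section PolyBounded.
Variables (R : realType) (D : set R[i]).
Implicit Types f g : R[i] -> R[i].

(** For the exponential factors, [D] is a horizontal strip of bounded height. *)
Definition polybounded f := exists C s, 0 <= C /\
  forall x, D x -> normc (f x) <= C * (1 + normc x) ^+ s.

Lemma polybounded_cst c : polybounded (fun=> c).
Proof.
by exists (normc c), 0%N; split=> [|x _]; rewrite ?normc_ge0 // expr0 mulr1.
Qed.

Lemma polybounded_id : polybounded id.
Proof.
by exists 1, 1%N; split=> // x _; rewrite expr1 mul1r lerDr.
Qed.

Lemma polyboundedD f g : polybounded f -> polybounded g ->
  polybounded (fun x => f x + g x).
Proof.
move=> [C1 [s1 [C1_ge0 fC]]] [C2 [s2 [C2_ge0 gC]]].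
exists (C1 + C2), (s1 + s2)%N; split=> [|x Dx]; first exact: addr_ge0.
have ge1 : 1 <= 1 + normc x by rewrite lerDl normc_ge0.
apply: le_trans (ler_normcD _ _) _; rewrite mulrDl.
apply: lerD; [apply: le_trans (fC x Dx) _|apply: le_trans (gC x Dx) _];
  by rewrite ler_wpM2l // ler_weXn2l // ?leq_addr ?leq_addl.
Qed.

Lemma polyboundedM f g : polybounded f -> polybounded g ->
  polybounded (fun x => f x * g x).
Proof.
move=> [C1 [s1 [C1_ge0 fC]]] [C2 [s2 [C2_ge0 gC]]].
exists (C1 * C2), (s1 + s2)%N; split=> [|x Dx]; first exact: mulr_ge0.
rewrite Normc.normcM exprD mulrACA.
by apply: ler_pM; rewrite ?normc_ge0 ?fC ?gC.
Qed.

Lemma polybounded_sum (I : Type) (s : seq I) (P : pred I)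
    (F : I -> R[i] -> R[i]) :
  (forall i, polybounded (F i)) ->
  polybounded (fun x => \sum_(i <- s | P i) F i x).
Proof.
move=> Fp; elim: s => [|i s IH].
  by under eq_fun do rewrite big_nil; exact: polybounded_cst.
under eq_fun do rewrite big_cons.
by case: (P i) => //; exact: polyboundedD.
Qed.

Lemma polybounded_prod (I : Type) (s : seq I) (P : pred I)
    (F : I -> R[i] -> R[i]) :
  (forall i, polybounded (F i)) ->
  polybounded (fun x => \prod_(i <- s | P i) F i x).
Proof.
move=> Fp; elim: s => [|i s IH].
  by under eq_fun do rewrite big_nil; exact: polybounded_cst.
under eq_fun do rewrite big_cons.
by case: (P i) => //; exact: polyboundedM.
Qed.

Lemma polybounded_mulmx m n p (A : R[i] -> 'M[R[i]]_(m, n))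
    (B : R[i] -> 'M[R[i]]_(n, p)) :
  (forall i j, polybounded (fun x => A x i j)) ->
  (forall i j, polybounded (fun x => B x i j)) ->
  forall i j, polybounded (fun x => (A x *m B x) i j).
Proof.
move=> Ap Bp i j; under eq_fun do rewrite mxE.
by apply: polybounded_sum => k; apply: polyboundedM.
Qed.

Lemma polybounded_det n (A : R[i] -> 'M[R[i]]_n) :
  (forall i j, polybounded (fun x => A x i j)) ->
  polybounded (fun x => \det (A x)).
Proof.
move=> Ap; rewrite /determinant; apply: polybounded_sum => s.
apply: polyboundedM; first exact: polybounded_cst.
by apply: polybounded_prod => i; exact: Ap.
Qed.

Lemma polybounded_adj n (A : R[i] -> 'M[R[i]]_n) :
  (forall i j, polybounded (fun x => A x i j)) ->
  forall i j, polybounded (fun x => (\adj (A x)) i j).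
Proof.
move=> Ap i j; under eq_fun do rewrite mxE.
apply: polyboundedM; first exact: polybounded_cst.
apply: polybounded_det => k l; under eq_fun do rewrite !mxE.
exact: Ap.
Qed.

(** This norm is submultiplicative with constant 1, so long products of matrices cost no factor
    depending on their size. *)
Definition mxnorm1 m n (A : 'M[R[i]]_(m, n)) := \sum_i \sum_j normc (A i j).

Lemma mxnorm1_ge0 m n (A : 'M[R[i]]_(m, n)) : 0 <= mxnorm1 A.
Proof. by do 2![apply: sumr_ge0 => ? _]; exact: normc_ge0. Qed.

Lemma ler_mxnorm1 m n (A : 'M[R[i]]_(m, n)) i j : normc (A i j) <= mxnorm1 A.
Proof.
rewrite /mxnorm1 (bigD1 i) //= (bigD1 j) //= -addrA lerDl addr_ge0 ?sumr_ge0 //.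
  by move=> ? _; exact: normc_ge0.
by move=> ? _; apply: sumr_ge0 => ? _; exact: normc_ge0.
Qed.

Lemma mxnorm1M m n p (A : 'M[R[i]]_(m, n)) (B : 'M[R[i]]_(n, p)) :
  mxnorm1 (A *m B) <= mxnorm1 A * mxnorm1 B.
Proof.
have rowB k : \sum_j normc (B k j) <= mxnorm1 B.
  rewrite /mxnorm1 (bigD1 k) //= lerDl sumr_ge0 // => ? _.
  by apply: sumr_ge0 => ? _; exact: normc_ge0.
rewrite {1 2}/mxnorm1 mulr_suml; apply: ler_sum => i _.
apply: (@le_trans _ _ (\sum_j \sum_k normc (A i k) * normc (B k j))).
  apply: ler_sum => j _; rewrite mxE; apply: le_trans (ler_normc_sum _ _ _) _.
  by apply: ler_sum => k _; rewrite Normc.normcM.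
rewrite exchange_big mulr_suml /=; apply: ler_sum => k _.
by rewrite -mulr_sumr ler_wpM2l ?normc_ge0.
Qed.

Lemma polybounded_mxnorm1 m n (A : R[i] -> 'M[R[i]]_(m, n)) :
  (forall i j, polybounded (fun x => A x i j)) ->
  exists C s, 0 <= C /\
    forall x, D x -> mxnorm1 (A x) <= C * (1 + normc x) ^+ s.
Proof.
move=> Ap.
have : polybounded (fun x => (mxnorm1 (A x))%:C).
  under eq_fun do rewrite /mxnorm1 rmorph_sum.
  apply: polybounded_sum => i; under eq_fun do rewrite rmorph_sum.
  apply: polybounded_sum => j; have [C [s [C_ge0 AC]]] := Ap i j.
  exists C, s; split=> // x Dx; rewrite normc_real ger0_norm ?normc_ge0 //.
  exact: AC.
move=> [C [s [C_ge0 AC]]].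
exists C, s; split=> // x Dx; apply: le_trans (AC x Dx).
by rewrite normc_real ger0_norm // mxnorm1_ge0.
Qed.

End PolyBounded.

(** * Block-diagonal matrices *)

Section Blocks.
Variable F : comUnitRingType.
Variables (t : nat) (m : 'I_t -> nat).

Lemma mul_mxdiag (A B : forall r, 'M[F]_(m r)) :
  (\mxdiag_r A r) *m (\mxdiag_r B r) = \mxdiag_r (A r *m B r).
Proof.
rewrite [in LHS]/(\mxdiag_r B r) mul_mxdiag_mxblock; apply: eq_mxblock => i j.
case: eqVneq => [e|]; last by rewrite mulmx0.
by case: j / e; rewrite !conform_mx_id.
Qed.

Lemma invmx_mxdiag (A : forall r, 'M[F]_(m r)) :
  (forall r, A r \in unitmx) ->
  \mxdiag_r A r \in unitmx /\ invmx (\mxdiag_r A r) = \mxdiag_r invmx (A r).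
Proof.
move=> Au.
have AV : (\mxdiag_r A r) *m (\mxdiag_r invmx (A r)) = 1%:M.
  by rewrite mul_mxdiag -mxdiagZ; apply: eq_mxdiag => r; rewrite mulmxV.
have [uA _] := mulmx1_unit AV; split=> //.
by rewrite -[LHS]mulmx1 -AV mulKmx.
Qed.

End Blocks.

Lemma polybounded_mxdiag (R : realType) (D : set R[i]) t (m : 'I_t -> nat)
    (A : R[i] -> forall r, 'M[R[i]]_(m r)) :
  (forall r i j, polybounded D (fun x => A x r i j)) ->
  forall i j, polybounded D (fun x => (\mxdiag_r A x r) i j).
Proof.
move=> Ap i j; under eq_fun do rewrite !mxE.
move: (tagnat.sig1 i) (tagnat.sig1 j) (tagnat.sig2 i) (tagnat.sig2 j) => r r'.
case: eqVneq => [e|_] u v; last first.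
  by under eq_fun do rewrite mxE; exact: polybounded_cst.
by case: r' / e v => v; under eq_fun do rewrite conform_mx_id.
Qed.

(** * The binomial matrices and their behaviour under unit translation *)

Section Bmx.
Variable R : realType.
Implicit Types x : R[i].

(** Pascal's rule for every integer [d]; at [d = 0] the last term has a negative lower index and is
    0. *)
Lemma cbinomD1 x (d : int) : cbinom (x + 1) d = cbinom x d + cbinom x (d - 1).
Proof.
case: d => [[|n]|n]; [by rewrite /= !big_ord0 addr0| |by rewrite /= addr0].
have -> : n.+1%:Z - 1 = n by lia.
rewrite /= big_ord_recl big_ord_recr /= subr0.
under eq_bigr => l _ do rewrite /bump leq0n natrD opprD addrA addrK.
set P := \prod_(_ < n) _.
rewrite factS natrM.
have : (n`!)%:R != 0 :> R[i] by rewrite pnatr_eq0 -lt0n fact_gt0.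
have : n.+1%:R != 0 :> R[i] by rewrite pnatr_eq0.
rewrite -natr1; move: (n%:R : R[i]) ((n`!)%:R : R[i]) P => a b P a0 b0.
by field; rewrite a0 b0.
Qed.

(** Upper negation of binomial coefficients: distribute the signs and reverse the order of the
    factors. *)
Lemma BmxE m x i j : Bmx m x i j = cbinom (- x) (i%:Z - j%:Z).
Proof.
rewrite mxE; case: (i%:Z - j%:Z) => n /=; last by rewrite mulr0.
rewrite -exprnP mulrA; congr (_ / _).
rewrite -[X in (-1) ^+ X]card_ord -prodr_const -big_split /=.
rewrite (reindex_inj rev_ord_inj) /=; apply: eq_bigr => l _.
by rewrite natrB // -natr1 pmulrn; ring.
Qed.

Lemma det_Bmx m x : \det (Bmx m x) = 1.
Proof.
rewrite det_trig; last first.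
  apply/is_trig_mxP => i j ltij; rewrite BmxE.
  by have [n ->] : exists n, i%:Z - j%:Z = Negz n by exists (j - i).-1%N; lia.
by rewrite big1 // => i _; rewrite BmxE subrr /= big_ord0 divr1.
Qed.

Lemma Bmx_unit m x : Bmx m x \in unitmx.
Proof. by rewrite unitmxE det_Bmx unitr1. Qed.

Lemma Bmx0 m : Bmx m (0 : R[i]) = 1%:M.
Proof.
apply/matrixP => i j; rewrite BmxE oppr0 !mxE.
case: (ltngtP i j) => ij.
- have [n ->] : exists n, i%:Z - j%:Z = Negz n by exists (j - i).-1%N; lia.
  by rewrite -val_eqE ltn_eqF.
- have [n ->] : exists n, i%:Z - j%:Z = Posz n.+1 by exists (i - j).-1%N; lia.
  by rewrite -val_eqE gtn_eqF //= big_ord_recl subrr !mul0r.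
- by move/val_inj: ij => ->; rewrite eqxx subrr /= big_ord0 divr1.
Qed.

Lemma jordanZ m (l : R[i]) : jordan m l = l%:M *m jordan m 1.
Proof.
apply/matrixP => i j; rewrite mul_scalar_mx !mxE.
by case: ifP; rewrite ?mulr1 ?mulr0.
Qed.

(** Column [j] of [jordan m 1] has ones in rows [j] and [j + 1] only, so each entry is Pascal's rule
    at [-(x + 1)]. *)
Lemma Bmx_shift m x : Bmx m x = Bmx m (x + 1) *m jordan m 1.
Proof.
apply/matrixP => i j; rewrite BmxE mxE.
under eq_bigr do rewrite BmxE mxE.
rewrite (bigD1 j) //= eqxx mulr1 (_ : - x = - (x + 1) + 1); last by ring.
rewrite cbinomD1; congr (_ + _).
have [ltj|gej] := ltnP j.+1 m.
  rewrite (bigD1 (Ordinal ltj)) //=; last by rewrite -val_eqE /= gtn_eqF.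
  rewrite eqxx orbT mulr1 big1 ?addr0; last first.
    move=> k /andP[/negPf -> kj]; rewrite /= -[k == j.+1 :> nat]/(k == Ordinal
      ltj).
    by rewrite (negPf kj) mulr0.
  by congr cbinom; lia.
(* In the last column there is no row [j + 1]; the second binomial then has negative lower index and
   vanishes too. *)
rewrite big1 => [|k /negPf -> /=]; last first.
  by have := ltn_ord k; case: eqP; rewrite ?mulr0 //; lia.
have [n ->] : exists n, i%:Z - j%:Z - 1 = Negz n.
  by exists (j - i)%N; have := ltn_ord i; have := ltn_ord j; lia.
by [].
Qed.

Lemma polybounded_cbinom (D : set R[i]) f (d : int) : polybounded D f ->
  polybounded D (fun x => cbinom (f x) d).
Proof.
move=> fp; case: d => n /=; last exact: polybounded_cst.
apply: polyboundedM; last exact: polybounded_cst.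
apply: polybounded_prod => l; apply: polyboundedD => //.
exact: polybounded_cst.
Qed.

(* [Bmx m x] has determinant 1, so its inverse is its adjugate. *)
Lemma polybounded_invBmx (D : set R[i]) m i j :
  polybounded D (fun x => (invmx (Bmx m x)) i j).
Proof.
under eq_fun do rewrite /invmx Bmx_unit det_Bmx invr1 scale1r.
apply: polybounded_adj => k l; under eq_fun do rewrite BmxE.
apply: polybounded_cbinom.
have -> : -%R = (fun x => -1 * x) :> (R[i] -> R[i]).
  by apply/funext => x; rewrite mulN1r.
by apply: polyboundedM; [exact: polybounded_cst|exact: polybounded_id].
Qed.

End Bmx.

(** * The complex exponential *)

Section CExp.
Variable R : realType.
Implicit Types z w : R[i].

Lemma cexpD z w : cexp (z + w) = cexp z * cexp w.
Proof.
case: z w => [a b] [c d]; rewrite /cexp /= expRD cosD sinD.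
by simpc; congr (_ +i* _); ring.
Qed.

Lemma cexp2piD z w : cexp2pi (z + w) = cexp2pi z * cexp2pi w.
Proof. by rewrite /cexp2pi mulrDr cexpD. Qed.

Lemma cexp2pi0 : cexp2pi 0 = 1 :> R[i].
Proof. by rewrite /cexp2pi mulr0 /cexp /= expR0 cos0 sin0 mulr1 mulr0. Qed.

Lemma cexp2pi1 : cexp2pi 1 = 1 :> R[i].
Proof.
rewrite /cexp2pi mulr1 /cexp /= expR0 !mul1r.
by rewrite mulrC mulr_natr cos2pi sin2pi.
Qed.

Lemma cexp2pi_int (n : int) : cexp2pi n%:~R = 1 :> R[i].
Proof.
have nat_case (k : nat) : cexp2pi k%:R = 1 :> R[i].
  by elim: k => [|k IH]; rewrite ?cexp2pi0 // -natr1 cexp2piD IH cexp2pi1 mul1r.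
case: n => k; first exact: nat_case.
have := cexp2piD k.+1%:R (Negz k)%:~R.
by rewrite NegzE mulrNz subrr cexp2pi0 nat_case mul1r => <-.
Qed.

Lemma normc_cexp2pi z : normc (cexp2pi z) = expR (- (2 * pi * complex.Im z)).
Proof.
case: z => a b; rewrite /cexp2pi /cexp /= !mul0r sub0r add0r.
rewrite !exprMn -mulrDr cos2Dsin2 mulr1 sqrtr_sqr ger0_norm ?expR_ge0 //.
Qed.

(** The modulus depends on the imaginary part only, so the function is even bounded on the strip,
    whence the exponent 0. *)
Lemma polybounded_cexp2pi (a Y : R) :
  polybounded [set x | `|complex.Im x| <= Y] (fun x : R[i] => cexp2pi (a%:C *
    x)).
Proof.
exists (expR (2 * pi * (`|a| * Y))), 0%N; split=> [|x yY].
  exact: expR_ge0.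
rewrite expr0 mulr1 normc_cexp2pi; case: x yY => x y /= yY.
rewrite mul0r addr0 ler_expR -mulrN.
rewrite ler_wpM2l ?mulr_ge0 ?pi_ge0 //.
apply: le_trans (ler_norm _) _; rewrite normrN normrM.
by rewrite ler_wpM2l.
Qed.

End CExp.

(** * The translation-equivariant matrix function *)

Section Equivariant.
Variables (R : realType) (t : nat) (m : 'I_t -> nat) (mu : 'I_t -> R).
Local Notation p := (\sum_r m r)%N.
Implicit Types (nu : 'I_t -> int) (x : R[i]).

(** The matrix [E x] of the overview. The case [nu = 0] controls [rho] on translations; the given
    [nu] enters the series. *)
Definition equivariant_mx nu x : 'M[R[i]]_p :=
  Lambda_rho m (fun r => cexp2pi (((nu r)%:~R + mu r)%:C * x))
    *m invmx (Brho m x).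

Lemma invmx_Brho x :
  Brho m x \in unitmx /\ invmx (Brho m x) = \mxdiag_r invmx (Bmx (m r) x).
Proof. by apply: invmx_mxdiag => r; exact: Bmx_unit. Qed.

Lemma equivariant_mx0 : equivariant_mx (fun=> 0) 0 = 1%:M.
Proof.
rewrite /equivariant_mx (invmx_Brho _).2 mul_mxdiag -mxdiagZ.
by apply: eq_mxdiag => r; rewrite mulr0 cexp2pi0 Bmx0 invmx1 mulmx1.
Qed.

Lemma polybounded_equivariant_mx nu (Y : R) i j :
  polybounded [set x | `|complex.Im x| <= Y] (fun x => equivariant_mx nu x i j).
Proof.
apply: polybounded_mulmx => [|k l].
  apply: (polybounded_mxdiag (A := fun x r =>
    (cexp2pi (((nu r)%:~R + mu r)%:C * x))%:M)) => r k l.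
  have -> : (fun x => (cexp2pi (((nu r)%:~R + mu r)%:C * x))%:M k l) =
      (fun x => cexp2pi (((nu r)%:~R + mu r)%:C * x) *+ (k == l)).
    by apply/funext => x; rewrite mxE.
  case: (k == l) => /=; last exact: polybounded_cst.
  exact: polybounded_cexp2pi.
have -> : (fun x => invmx (Brho m x) k l) =
    (fun x => (\mxdiag_r invmx (Bmx (m r) x)) k l).
  by apply/funext => x; rewrite (invmx_Brho _).2.
by apply: polybounded_mxdiag => r u v; exact: polybounded_invBmx.
Qed.

(** The integer [nu r] contributes the factor 1; the scalar from [mu r] and the unipotent factor
    from [Bmx_shift] combine to the Jordan block. *)
Lemma equivariant_mxD1 nu x :
  equivariant_mx nu (x + 1) =
  jordan_diag m (fun r => cexp2pi (mu r)%:C) *m equivariant_mx nu x.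
Proof.
rewrite /equivariant_mx !(invmx_Brho _).2 !mul_mxdiag.
apply: eq_mxdiag => r; rewrite jordanZ.
have -> : cexp2pi (((nu r)%:~R + mu r)%:C * (x + 1)) =
    cexp2pi (((nu r)%:~R + mu r)%:C * x) * cexp2pi (mu r)%:C.
  rewrite mulrDr mulr1 rmorphD /= cexp2piD; congr (_ * _).
  by rewrite cexp2piD rmorph_int cexp2pi_int mul1r.
set J := jordan _ 1.
have -> : invmx (Bmx (m r) (x + 1)) = J *m invmx (Bmx (m r) x).
  rewrite -[LHS]mulmx1 -(mulmxV (Bmx_unit (m r) x)) {1}(Bmx_shift (m r) x).
  by rewrite !mulmxA mulVmx ?Bmx_unit // mul1mx.
by rewrite !mul_scalar_mx -scalemxAl -scalemxAr scalerA mulrC.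
Qed.

End Equivariant.

(** * Translations, cosets and a Euclidean step in the modular group *)

Section SL2Z.
Implicit Types (M N : SL2Z) (a b c d n : int).

Lemma ord2P (i : 'I_2) : i = 0 \/ i = 1.
Proof. by case: i => -[|[|//]] ?; [left|right]; apply/val_inj. Qed.

Lemma sum_ord2 (V : nmodType) (h : 'I_2 -> V) : \sum_i h i = h 0 + h 1.
Proof.
by rewrite !big_ord_recl big_ord0 addr0; congr (_ + h _); apply/val_inj.
Qed.

Lemma det_mx2 (A : 'M[int]_2) : \det A = A 0 0 * A 1 1 - A 0 1 * A 1 0.
Proof.
rewrite (expand_det_row _ 0) sum_ord2 /cofactor !det_mx11 !mxE /=.
rewrite expr0 expr1 mul1r mulN1r mulrN; congr (A _ _ * A _ _ - A _ _ * A _ _);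
  exact/val_inj.
Qed.

Lemma sl2_mulE M N i j : (M * N)%g i j = M i 0 * N 0 j + M i 1 * N 1 j.
Proof. by rewrite mxE sum_ord2. Qed.

Lemma sl2_detE M : M 0 0 * M 1 1 - M 0 1 * M 1 0 = 1.
Proof. by rewrite -det_mx2 sl2_det. Qed.

Lemma sl2_eqP M N : M 0 0 = N 0 0 -> M 0 1 = N 0 1 -> M 1 0 = N 1 0 ->
  M 1 1 = N 1 1 -> M = N.
Proof.
move=> e00 e01 e10 e11; apply/val_inj/matrixP => i j.
by case: (ord2P i) => ->; case: (ord2P j) => ->.
Qed.

Definition mx2 a b c d : 'M[int]_2 :=
  \matrix_(i, j) if i == 0 then (if j == 0 then a else b)
                 else (if j == 0 then c else d).

Fact mx2_det a b c d : a * d - b * c = 1 -> \det (mx2 a b c d) == 1.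
Proof. by move=> e; rewrite det_mx2 !mxE /= e. Qed.

Definition sl2_of a b c d (e : a * d - b * c = 1) := MkSL2Z (mx2_det e).

Fact sl2_Tz_det n : 1 * 1 - n * 0 = 1 :> int. Proof.
  by rewrite mulr0 subr0. Qed.
Definition sl2_Tz n := sl2_of (sl2_Tz_det n).

Fact sl2_S_det : 0 * 0 - (- 1) * 1 = 1 :> int. Proof. by []. Qed.
Definition sl2_S := sl2_of sl2_S_det.

Lemma sl2_TzD n1 n2 : sl2_Tz (n1 + n2) = (sl2_Tz n1 * sl2_Tz n2)%g.
Proof. by apply: sl2_eqP; rewrite sl2_mulE !mxE /=; ring. Qed.

Lemma sl2_Tz0 : sl2_Tz 0 = 1%g.
Proof. by apply: sl2_eqP; rewrite !mxE. Qed.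

Lemma sl2_TzV n : sl2_Tz (- n) = (sl2_Tz n)^-1%g.
Proof.
by rewrite -[RHS]mulg1 -sl2_Tz0 -(subrr n) sl2_TzD mulKg.
Qed.

Lemma sl2_TX (k : nat) : (sl2_T ^+ k)%g = sl2_Tz k.
Proof.
elim: k => [|k IH]; first by rewrite expg0 sl2_Tz0.
rewrite expgS IH -[k.+1]add1n PoszD sl2_TzD; congr (_ * _)%g.
by apply: sl2_eqP; rewrite !mxE.
Qed.

Lemma cyclic_TP M : cyclic_T M <-> exists n, M = sl2_Tz n.
Proof.
split=> [[k []] ->|[[k|k] ->]].
- by exists k; rewrite sl2_TX.
- by exists (- k%:Z); rewrite sl2_TX sl2_TzV.
- by exists k; left; rewrite sl2_TX.
- by exists k.+1; right; rewrite NegzE sl2_TX sl2_TzV.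
Qed.

Lemma sl2_invE M : [/\ M^-1%g 0 0 = M 1 1, M^-1%g 0 1 = - M 0 1,
  M^-1%g 1 0 = - M 1 0 & M^-1%g 1 1 = M 0 0].
Proof.
have e : M 1 1 * M 0 0 - (- M 0 1) * (- M 1 0) = 1.
  by rewrite -(sl2_detE M); ring.
suff -> : M^-1%g = sl2_of e by split; rewrite mxE.
have -> : sl2_of e = (M^-1 * (M * sl2_of e))%g by rewrite mulKg.
have -> : (M * sl2_of e)%g = 1%g; last by rewrite mulg1.
have := sl2_detE M => dM.
by apply: sl2_eqP; rewrite sl2_mulE !mxE /= -?dM; ring.
Qed.

Lemma sl2_lower0 M : M 1 0 = 0 -> M 1 1 = 1 -> M = sl2_Tz (M 0 1).
Proof.
move=> c0 d1; have := sl2_detE M; rewrite c0 d1 mulr0 subr0 mulr1 => a1.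
by apply: sl2_eqP; rewrite !mxE.
Qed.

(** The determinant forces both diagonal entries to be 1 or both to be -1; [sl2_S * sl2_S] is minus
    the identity. *)
Lemma sl2_lower0N M : M 1 0 = 0 ->
  M = sl2_Tz (M 0 1) \/ M = (sl2_Tz (- M 0 1)%R * (sl2_S * sl2_S))%g.
Proof.
move=> c0; have := sl2_detE M; rewrite c0 mulr0 subr0 => ad1.
have [[a1 d1]|[a1 d1]] : M 0 0 = 1 /\ M 1 1 = 1 \/ M 0 0 = -1 /\ M 1 1 = -1.
- have /eqP := congr1 absz ad1; rewrite abszM muln_eq1 => /andP[/eqP a1 /eqP
  d1].
  by move: (M 0 0) (M 1 1) ad1 a1 d1 => a d; lia.
- by left; apply: sl2_lower0.
- by right; apply: sl2_eqP; rewrite !(sl2_mulE, mxE) /= ?c0 ?a1 ?d1; lia.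
Qed.

(** The quotient [M * N^-1] has lower row [(0, 1)], hence is a translation. *)
Lemma lower_row_coset M N : M 1 0 = N 1 0 -> M 1 1 = N 1 1 ->
  exists n, M = (sl2_Tz n * N)%g.
Proof.
move=> ec ed; exists ((M * N^-1)%g 0 1).
have [i00 i01 i10 i11] := sl2_invE N; have detN := sl2_detE N.
rewrite -sl2_lower0; first by rewrite -mulgA mulVg mulg1.
  by rewrite sl2_mulE i00 i10 ec ed; ring.
by rewrite sl2_mulE i01 i11 ec ed -detN; ring.
Qed.

(** This turns sums over representatives into sums over distinct pairs [(c, d)]. *)
Lemma coset_reps_inj (Rep : set SL2Z) M N : coset_reps Rep ->
  Rep M -> Rep N -> M 1 0 = N 1 0 -> M 1 1 = N 1 1 -> M = N.
Proof.
move=> reps RM RN ec ed; have [P [_ P_uniq]] := reps M.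
have <- : P = M.
  by apply: P_uniq; split=> //; apply/cyclic_TP; exists 0;
    rewrite mulgV sl2_Tz0.
apply: P_uniq; split=> //; apply/cyclic_TP.
by have [n ->] := lower_row_coset ec ed; exists n; rewrite -mulgA mulgV mulg1.
Qed.

Lemma nearest_multiple a c : c != 0 -> exists l : int, (2 * `|(a - l * c)%R|
  <= `|c|)%N.
Proof.
move=> c0; have := divz_eq a c; have := modz_ge0 a c0; have := ltz_mod a c0.
move: (a %/ c)%Z (a %% c)%Z => q r.
(* The remainder satisfies [0 <= r < |c|]; if it exceeds [|c| / 2], the neighbouring multiple of [c]
   is closer, on the side given by the sign of [c]. *)
have [r_small|r_big] := leqP (2 * `|r|) `|c|.
  by move=> _ _ ->; exists q; rewrite addrAC subrr add0r.
move=> ltr r0 ->; have [c_gt0|c_le0] := ltP 0 c.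
  exists (q + 1); rewrite (_ : q * c + r - (q + 1) * c = r - c);
    last by ring. lia.
exists (q - 1); rewrite (_ : q * c + r - (q - 1) * c = r + c); last by ring.
lia.
Qed.

(** Euclid's algorithm on the first column: [(a, c)] becomes [(c, l c - a)], with [l] a nearest
    integer to [a / c]. *)
Lemma euclid_step M : M 1 0 != 0 -> exists (l : int) N,
  [/\ (M = sl2_Tz l * (sl2_S * N))%g, N 0 0 = M 1 0, N 0 1 = M 1 1,
      N 1 0 = l * M 1 0 - M 0 0 & (2 * `|(N 1 0)%R| <= `|(M 1 0)%R|)%N].
Proof.
move=> c0; have [l le_l] := nearest_multiple (M 0 0) c0.
have e : M 1 0 * (l * M 1 1 - M 0 1) - M 1 1 * (l * M 1 0 - M 0 0) = 1.
  by rewrite -(sl2_detE M); ring.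
exists l, (sl2_of e); split; try by rewrite !mxE.
  by apply: sl2_eqP; rewrite !(sl2_mulE, mxE) /=; lia.
by move: le_l; rewrite !mxE /= -abszN opprB.
Qed.

End SL2Z.

(** * Polynomial growth of the representation along Euclid's algorithm *)

Section Growth.
Variables (R : realType) (p : nat) (rho : SL2Z -> 'M[R[i]]_p).
Hypothesis rho_rep : is_representation rho.
Variables (CT : R) (s : nat).
Hypothesis CT_ge0 : 0 <= CT.
Hypothesis rho_Tz : forall n : int,
  mxnorm1 (rho (sl2_Tz n)) <= CT * (1 + `|n|%N%:R) ^+ s.

(** The terminal case of the recursion. The summand 1 covers translations, the square covers a
    translation times minus the identity. *)
Lemma rho_lower0 (N : SL2Z) (L : nat) : N 1 0 = 0 -> (`|(N 0 1)%R| <= L)%N ->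
  mxnorm1 (rho N) <= (1 + mxnorm1 (rho sl2_S) ^+ 2) * CT * (1 + L%:R) ^+ s.
Proof.
have [_ rhoM] := rho_rep; move=> c0 leL.
have TzL (n : int) : (`|n| <= L)%N ->
    mxnorm1 (rho (sl2_Tz n)) <= CT * (1 + L%:R) ^+ s.
  move=> nL; apply: le_trans (rho_Tz n) _; rewrite ler_wpM2l //.
  by rewrite lerXn2r ?nnegrE ?addr_ge0 // lerD2l ler_nat.
have CL_ge0 : 0 <= CT * (1 + L%:R) ^+ s.
  by rewrite mulr_ge0 // exprn_ge0 // addr_ge0.
rewrite -mulrA mulrDl mul1r.
have [->|->] := sl2_lower0N c0.
  by apply: le_trans (TzL _ leL) _; rewrite lerDl mulr_ge0 // sqr_ge0.
rewrite !rhoM; apply: le_trans (mxnorm1M _ _) _; rewrite mulrC.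
apply: ler_wpDl => //; apply: ler_pM; rewrite ?mxnorm1_ge0 //.
  exact: mxnorm1M.
by apply: TzL; rewrite abszN.
Qed.

Lemma exists_exp2_ge (x : R) : exists n, x <= 2 ^+ n.
Proof.
exists (Num.bound `|x|); apply: le_trans (ler_norm x) _.
apply: ltW; apply: lt_le_trans (archi_boundP (normr_ge0 x)) _.
by rewrite -natrX ler_nat ltnW // ltn_expl.
Qed.

(** Induction on [|c|]. A Euclidean step costs [kap * (1 + |l|) ^+ s]: the quotient is paid for by
    the passage from [|a| + |c|] to [|c| + |c'|], the constants by the halving of [|c|]. The bound
    [L] on [|d|] survives every step and is used at the end. *)
Lemma representation_growth : exists A al, 0 <=
  A /\ forall (M : SL2Z) (L : nat),
  M 1 0 != 0 -> (0 < L)%N -> (`|(M 1 1)%R| <= L)%N ->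
  mxnorm1 (rho M) <= A * (`|(M 0 0)%R| + `|(M 1 0)%R|)%N%:R ^+ s
                       * (`|(M 1 0)%R|%N)%:R ^+ al * (1 + L%:R) ^+ s.
Proof.
have [_ rhoM] := rho_rep.
pose sg := mxnorm1 (rho sl2_S); pose kap := CT * sg.
have sg_ge0 : 0 <= sg := mxnorm1_ge0 _.
have kap_ge0 : 0 <= kap by rewrite mulr_ge0.
(* Halving [|c|] gains [2 ^+ al], which must outweigh the constants [kap * 4 ^+ s] of one step. *)
have [al le_al] := exists_exp2_ge (kap * 4 ^+ s).
pose A := kap * ((1 + sg ^+ 2) * CT).
have A_ge0 : 0 <= A by rewrite !mulr_ge0 // addr_ge0 // sqr_ge0.
exists A, al; split=> // M L; have [n] := ubnP `|(M 1 0)%R|%N.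
elim: n M => // n IH M ltn c0 L_gt0 leL.
have [l [N [eM N00 N01 N10 leN]]] := euclid_step c0.
have step : mxnorm1 (rho M) <= kap * (1 + `|l|%N%:R) ^+ s * mxnorm1 (rho N).
  rewrite eM !rhoM; apply: le_trans (mxnorm1M _ _) _.
  apply: (@le_trans _ _ (CT * (1 + `|l|%N%:R) ^+ s * (sg * mxnorm1 (rho N)))).
    by apply: ler_pM; rewrite ?mxnorm1_ge0 ?mxnorm1M ?rho_Tz.
  by rewrite le_eqVlt; apply/orP; left; apply/eqP; rewrite /kap; ring.
have W_ge0 : 0 <= (1 + L%:R : R) ^+ s by rewrite exprn_ge0 // addr_ge0.
apply: le_trans step _.
have [n0|n0] := eqVneq (N 1 0) 0.
  have eN : mxnorm1 (rho N) <= (1 + sg ^+ 2) * CT * (1 + L%:R) ^+ s.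
    by apply: rho_lower0 => //; rewrite N01.
  have := sl2_detE M; move: N10; rewrite n0 => /esym/eqP;
    rewrite subr_eq0 => /eqP <-.
  rewrite -mulrA [_ * M 1 1]mulrC mulrA => det1.
  (* When the recursion stops, [a = l c], so [c] divides the determinant; then [|a| + |c| = |l| + 1]
     is exactly the factor of the step. *)
  have c1 : `|(M 1 0)%R|%N = 1%N.
    have : `|((l * M 1 1 - M 0 1) * M 1 0)%R|%N = 1%N
      by rewrite -[RHS]/(`|(1:int)%R|%N) -det1; congr absz; ring.
    by rewrite abszM => /eqP; rewrite muln_eq1 => /andP[_ /eqP].
  rewrite abszM c1 expr1n mulr1 muln1 addn1 -[_.+1%:R]natr1 [_ + 1]addrC.
  apply: le_trans (ler_wpM2l _ eN) _; first
    by rewrite mulr_ge0 // exprn_ge0 // addr_ge0.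
  by rewrite le_eqVlt; apply/orP; left; apply/eqP; rewrite /A; ring.
have lt_c : (`|(N 1 0)%R| < n)%N by move: (leN) (ltn) c0 n0; lia.
(* From [c d' - d c' = 1] and [2 |c'| <= |c|], [|d'|] is at most [(1 + L) / 2]; here [L > 0]
   matters. *)
have leL' : (`|(N 1 1)%R| <= L)%N.
  have := sl2_detE N; rewrite N00 N01.
  move: (N 1 0) (M 1 0) (M 1 1) (N 1 1) leN n0 leL => c' c d d' le_c' c'0 le_d
    det1.
  have : (`|c| * `|d'| <= 1 + `|d| * `|c'|)%N.
    by rewrite -!abszM; lia.
  have : (`|d| * `|c'| <= L * `|c'|)%N by rewrite leq_mul2r le_d orbT.
  nia.
have := IH N lt_c n0 L_gt0 leL'.
move=> /(ler_wpM2l (_ : 0 <= kap * (1 + `|l|%N%:R) ^+ s)) H.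
apply: le_trans (H _) _; first by rewrite mulr_ge0 // exprn_ge0 // addr_ge0.
rewrite N00.
set X := (1 + _ : R) in H *.
set Y := (_ + _)%N%:R; set Z := (_ + _)%N%:R.
set c' := (`|(N 1 0)%R|%N)%:R; set c := (`|(M 1 0)%R|%N)%:R.
set W := (1 + L%:R) ^+ s.
(* The telescoping inequality: [|l| |c| <= |a| + |c'|] because [c' = l c - a], and [|c'|] is at most
   [|c| / 2]. *)
have XY : X * Y <= 4 * Z.
  rewrite /X /Y /Z -[1 in X in X <= _]/(1%:R) -natrD -!natrM ler_nat.
  move: (M 1 0) (M 0 0) (N 1 0) leN N10 => u a u' le_u' e.
  have lu : (`|l| * `|u| <= `|a| + `|u'|)%N by rewrite -abszM e; lia.
  have lu' : (`|l| * (2 * `|u'|) <= `|l| * `|u|)%N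
    by rewrite leq_mul2l le_u' orbT.
  lia.
have cc : 2 * c' <= c by rewrite /c /c' -natrM ler_nat.
have -> : kap * X ^+ s * (A * Y ^+ s * c' ^+ al * W) =
  (A * W) * (kap * (X * Y) ^+ s * c' ^+ al) by rewrite exprMn; ring.
have -> : A * Z ^+ s * c ^+ al * W = (A * W) * (Z ^+ s * c ^+ al) by ring.
apply: ler_wpM2l; first exact: mulr_ge0.
apply: (@le_trans _ _ (kap * (4 * Z) ^+ s * c' ^+ al)).
  rewrite ler_wpM2r ?exprn_ge0 // ler_wpM2l // lerXn2r ?nnegrE ?mulr_ge0 //.
  by rewrite addr_ge0.
rewrite exprMn.
apply: (@le_trans _ _ (2 ^+ al * Z ^+ s * c' ^+ al)).
  by rewrite ler_wpM2r ?exprn_ge0 // mulrA ler_wpM2r // exprn_ge0.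
have -> : 2 ^+ al * Z ^+ s * c' ^+ al = Z ^+ s * (2 * c') ^+ al.
  by rewrite exprMn; ring.
by rewrite ler_wpM2l ?exprn_ge0 // lerXn2r ?nnegrE ?mulr_ge0.
Qed.

End Growth.

(** * The automorphy factor and the Moebius action on the strip *)

Section Automorphy.
Variable R : realType.
Implicit Types (M : SL2Z) (tau : R[i]).

Lemma intrC (n : int) : n%:~R = (n%:~R : R)%:C.
Proof. by rewrite rmorph_int. Qed.

Lemma normc_int (n : int) : normc (n%:~R : R[i]) = `|n|%N%:R.
Proof. by rewrite intrC normc_real -intr_norm natr_absz. Qed.

Lemma lower_row_gt0 M : (0 < `|(M 1 0)%R| + `|(M 1 1)%R|)%N.
Proof.
have := sl2_detE M; case: posnP => // /eqP; rewrite addn_eq0 !absz_eq0.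
by move=> /andP[/eqP -> /eqP ->]; rewrite !mulr0.
Qed.

(** The squared modulus is [(c x + d)^2 + (c y)^2] with [y^2 >= 3/4]. If [|d| < |c| / 2] the second
    square suffices; otherwise [|c x + d| >= |d| - |c| / 2], and [c^2 - |c d| + d^2] exceeds
    [(|c| + |d|)^2 / 4] by [3/4 (|c| - |d|)^2]. *)
Lemma normc_automorphy_ge M tau : fund_strip R tau ->
  (`|(M 1 0)%R| + `|(M 1 1)%R|)%N%:R / 2 <= normc (automorphy M tau).
Proof.
case: tau => x y [/= y_gt0 x_le y_ge].
rewrite /automorphy !intrC natrD !natr_absz !intr_norm.
move: ((M 1 0)%:~R : R) ((M 1 1)%:~R : R) => c d.
have -> : c%:C * (x +i* y) + d%:C = (c * x + d) +i* (c * y) by simpc.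
have u_ge0 := normr_ge0 c; have v_ge0 := normr_ge0 d.
rewrite /= -[X in X <= _]ger0_norm ?divr_ge0 ?addr_ge0 // -sqrtr_sqr.
apply: ler_wsqrtr.
have y2 : 3 / 4 <= y ^+ 2.
  have -> : 3 / 4 = (Num.sqrt 3 / 2) ^+ 2 :> R.
    by rewrite expr_div_n sqr_sqrtr //; field.
  by rewrite lerXn2r ?nnegrE ?divr_ge0 ?sqrtr_ge0 // ltW.
have cy : 3 / 4 * `|c| ^+ 2 <= (c * y) ^+ 2.
  by rewrite exprMn real_normK ?num_real // mulrC ler_wpM2l // sqr_ge0.
have [small|big] := ltP (`|d|) (`|c| / 2).
  have : 0 <= (c * x + d) ^+ 2 := sqr_ge0 _.
  move: (`|c|) (`|d|) ((c * x + d) ^+ 2) ((c * y) ^+ 2) cy small u_ge0 v_ge0.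
  move=> u v e f cy small u_ge0 v_ge0 e0.
  have : 0 <= (u / 2 - v) * (5 / 2 * u + v) by apply: mulr_ge0; lra.
  nra.
have low : `|d| - `|c| / 2 <= `|c * x + d|.
  have : `|d| <= `|c * x + d| + `|c * x|.
    by rewrite -[X in `|X| <= _](addrK (c * x)) [d + _]addrC ler_normB.
  rewrite normrM; have : `|c| * `|x| <= `|c| * 2^-1 by rewrite ler_wpM2l.
  lra.
have : (`|d| - `|c| / 2) ^+ 2 <= (c * x + d) ^+ 2.
  by rewrite -[X in _ <= X]real_normK ?num_real // lerXn2r ?nnegrE ?subr_ge0.
move: (`|c|) (`|d|) ((c * x + d) ^+ 2) ((c * y) ^+ 2) cy => u v e f cy e0.
have := sqr_ge0 (u - v); nra.
Qed.

Lemma automorphy_neq0 M tau : fund_strip R tau -> automorphy M tau != 0.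
Proof.
move=> /(normc_automorphy_ge M) le_norm; apply/eqP => e; move: le_norm.
rewrite e Normc.normc0 leNgt divr_gt0 //.
by rewrite ltr0n lower_row_gt0.
Qed.

Lemma automorphy_Tz n M tau :
  automorphy (sl2_Tz n * M)%g tau = automorphy M tau.
Proof. by rewrite /automorphy !sl2_mulE !mxE /= !mul0r !add0r !mul1r. Qed.

Lemma mobius_Tz n M tau : automorphy M tau != 0 ->
  mobius (sl2_Tz n * M)%g tau = mobius M tau + n%:~R.
Proof.
move=> nz; rewrite {1}/mobius automorphy_Tz /mobius !sl2_mulE !mxE /= !mul1r.
rewrite -[n%:~R in RHS](mulfK nz) -mulrDl; congr (_ / _).
by rewrite /automorphy !rmorphD !rmorphM /=; ring.
Qed.

(** Write the image as [a/c - 1/(c (c tau + d))]: the first term is at most 1 and the second at most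
    2, since [|c tau + d| >= 1/2]. *)
Lemma normc_mobius_le M tau : fund_strip R tau -> M 1 0 != 0 ->
  (2 * `|(M 0 0)%R| <= `|(M 1 0)%R|)%N -> normc (mobius M tau) <= 3.
Proof.
move=> tauS c0 le_a; have nz := automorphy_neq0 M tauS.
have := normc_automorphy_ge M tauS; set z := automorphy M tau in nz * => le_z.
have cC : (M 1 0)%:~R != 0 :> R[i] by rewrite intr_eq0.
have -> : mobius M tau = ((M 0 0)%:~R - z^-1) / (M 1 0)%:~R.
  rewrite /mobius -/z; apply/eqP.
  rewrite (eqr_div _ _ nz cC) mulrBl mulVf //; apply/eqP.
  have := sl2_detE M => /(congr1 (fun n : int => n%:~R : R[i])).
  rewrite rmorphB !rmorphM rmorph1 /= => e; rewrite -[X in _ = _ - X]e.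
  by rewrite /z /automorphy; ring.
rewrite Normc.normcM Normc.normcV normc_int.
have c1 : (1 : R) <= `|(M 1 0)%R|%N%:R by rewrite ler1n lt0n absz_eq0.
rewrite ler_pdivrMr ?(lt_le_trans ltr01) //.
apply: le_trans (ler_normcD _ _) _.
rewrite (_ : normc (- z^-1) = normc z^-1) ?normcN // Normc.normcV normc_int.
have : (`|(M 0 0)%R|%N%:R : R) <= `|(M 1 0)%R|%N%:R.
  by rewrite ler_nat (leq_trans _ le_a) // leq_pmull.
have z2 : 2^-1 <= normc z.
  apply: le_trans le_z; rewrite ler_pdivlMr // mulVf // ler1n.
  exact: lower_row_gt0.
have : (normc z)^-1 <= 2.
  by rewrite -[2]invrK lef_pV2 ?posrE ?invr_gt0 // (lt_le_trans _ z2) //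
    invr_gt0.
lra.
Qed.

End Automorphy.

(** * Translation law for the given representation and invariance of the summands *)

Section Terms.
Variables (R : realType) (t : nat) (m : 'I_t -> nat).
Local Notation p := (\sum_r m r)%N.
Variables (rho : SL2Z -> 'M[R[i]]_p) (mu : 'I_t -> R) (nu : 'I_t -> int).
Hypothesis rho_rep : is_representation rho.
Hypothesis rho_T : rho sl2_T = jordan_diag m (fun r => cexp2pi (mu r)%:C).

Lemma rhoV M : invmx (rho M) = rho M^-1%g.
Proof.
have [rho1 rhoM] := rho_rep.
have e : rho M *m rho M^-1%g = 1%:M by rewrite -rhoM mulgV rho1.
have [u _] := mulmx1_unit e.
by rewrite -[LHS]mulmx1 -e mulKmx.
Qed.

Lemma equivariant_mxD (nu' : 'I_t -> int) (n : int) (x : R[i]) :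
  equivariant_mx m mu nu' (x + n%:~R) =
  rho (sl2_Tz n) *m equivariant_mx m mu nu' x.
Proof.
have [rho1 rhoM] := rho_rep.
have nat_case (k : nat) y : equivariant_mx m mu nu' (y + k%:R) =
    rho (sl2_Tz k) *m equivariant_mx m mu nu' y.
  elim: k => [|k IH]; first by rewrite addr0 sl2_Tz0 rho1 mul1mx.
  rewrite -natr1 addrA equivariant_mxD1 IH mulmxA -rho_T -rhoM.
  by rewrite -!sl2_TX expgS.
case: n => k; first exact: nat_case.
(* A negative translation is undone by the positive one starting from the translated point. *)
have := nat_case k.+1 (x + (Negz k)%:~R).
rewrite NegzE mulrNz subrK => ->.
by rewrite sl2_TzV mulmxA -rhoM mulVg rho1 mul1mx.
Qed.

(** For [nu = 0] the equivariant matrix is the identity at 0, so its value at [n] is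
    [rho (sl2_Tz n)]; integers lie in the strip of height 0. *)
Lemma rho_Tz_growth : exists CT s, 0 <= CT /\ forall n : int,
  mxnorm1 (rho (sl2_Tz n)) <= CT * (1 + `|n|%N%:R) ^+ s.
Proof.
have [C [s [C_ge0 EC]]] := polybounded_mxnorm1
  (polybounded_equivariant_mx (m := m) mu (fun=> 0) 0).
exists C, s; split=> // n.
have := EC (0 + n%:~R); rewrite equivariant_mxD equivariant_mx0 mulmx1.
by rewrite add0r normc_int; apply; rewrite /= intrC /= normr0.
Qed.

Variable k : 'I_p -> int.

Lemma poincare_termE M tau i j : automorphy M tau != 0 ->
  poincare_term rho mu nu k M tau i j =
  (rho M^-1%g *m equivariant_mx m mu nu (mobius M tau)) i j
    * (automorphy M tau ^ k j)^-1.
Proof.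
move=> nz; rewrite /poincare_term rhoV -[_ *m _ *m invmx (Brho _ _)]mulmxA.
set A := rho _ *m _.
have JV : Jk k M tau *m diag_mx (\row_l (automorphy M tau ^ k l)^-1) = 1%:M.
  apply/matrixP => a b; rewrite mul_diag_mx !mxE.
  case: eqVneq => [->|_]; last by rewrite mulr0.
  by rewrite !mulr1n divff // expfz_neq0.
have [uJ _] := mulmx1_unit JV.
have -> : invmx (Jk k M tau) = diag_mx (\row_l (automorphy M tau ^ k l)^-1).
  by rewrite -[LHS]mulmx1 -JV mulKmx.
by rewrite mul_mx_diag !mxE.
Qed.

(** The translation law produces [rho (sl2_Tz n)], which cancels against its inverse in
    [rho (sl2_Tz n * M)^-1]; the automorphy factor sees only the lower row. *)
Lemma poincare_term_coset n M tau i j : automorphy M tau != 0 ->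
  poincare_term rho mu nu k (sl2_Tz n * M)%g tau i j =
  poincare_term rho mu nu k M tau i j.
Proof.
have [rho1 rhoM] := rho_rep; move=> nz.
have nz' : automorphy (sl2_Tz n * M)%g tau != 0 by rewrite automorphy_Tz.
rewrite (poincare_termE _ _ nz') (poincare_termE _ _ nz) automorphy_Tz.
rewrite (mobius_Tz n nz) equivariant_mxD invgM rhoM mulmxA.
by rewrite -[_ *m rho (sl2_Tz n)]mulmxA -rhoM mulVg rho1 mulmx1.
Qed.

End Terms.

(** * The summable weight of a lower row *)

Definition row_weight (R : realType) (M : SL2Z) : R :=
  int_weight R (M 1 0) * int_weight R (M 1 1).

Section RowWeight.
Variable R : realType.
Implicit Types M : SL2Z.

Lemma row_weight_ge0 M : 0 <= row_weight R M.
Proof. by rewrite mulr_ge0 // int_weight_ge0. Qed.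

(** Here [|d| = 1]. The value later serves as the threshold below which [c] cannot vanish. *)
Lemma row_weight_lower0 M : M 1 0 = 0 -> row_weight R M = 4^-1.
Proof.
move=> c0; rewrite /row_weight c0; have := sl2_detE M.
rewrite c0 mulr0 subr0 => /(congr1 absz) /eqP.
rewrite abszM muln_eq1 => /andP[_ /eqP d1].
by rewrite /int_weight d1 addr0 expr1n invr1 mul1r; congr (_^-1); ring.
Qed.

(** Both [1 + |c|] and [1 + |d|] are at most [2 (|c| + |d|)], and [16 = 2^4]. *)
Lemma row_weight_ge M :
  (`|(M 1 0)%R| + `|(M 1 1)%R|)%N%:R ^- 4 <= 16 * row_weight R M.
Proof.
have := lower_row_gt0 M; rewrite /row_weight /int_weight.
move: (`|(M 1 0)%R|%N) (`|(M 1 1)%R|%N) => c d q_gt0.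
have q1 : (1 : R) <= (c + d)%N%:R by rewrite ler1n.
have cq : (1 + c%:R : R) <= 2 * (c + d)%N%:R.
  by rewrite -[1 in X in X <= _]/(1%:R) -natrD -natrM ler_nat; lia.
have dq : (1 + d%:R : R) <= 2 * (c + d)%N%:R.
  by rewrite -[1 in X in X <= _]/(1%:R) -natrD -natrM ler_nat; lia.
move: (_%N%:R) q1 cq dq => q q1 cq dq.
have q0 : 0 < q := lt_le_trans ltr01 q1.
have c0 : 0 < 1 + c%:R :> R by rewrite ltr_wpDr.
have d0 : 0 < 1 + d%:R :> R by rewrite ltr_wpDr.
have cd0 : 0 < (1 + c%:R) ^+ 2 * (1 + d%:R : R) ^+ 2
  by rewrite mulr_gt0 ?exprn_gt0.
rewrite -invfM ler_pdivlMr // mulrC ler_pdivrMr ?exprn_gt0 //.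
rewrite (_ : 16 * q ^+ 4 = (2 * q) ^+ 2 * (2 * q) ^+ 2); last by ring.
by apply: ler_pM; rewrite ?sqr_ge0 // lerXn2r ?nnegrE ?(ltW c0) ?(ltW d0) //
  mulr_ge0 // ltW.
Qed.

Lemma sum_row_weight_le (Rep : set SL2Z) (s : seq SL2Z) :
  coset_reps Rep -> uniq s -> (forall M, M \in s -> Rep M) ->
  \sum_(M <- s) row_weight R M <= 16.
Proof.
move=> reps us sRep.
have := @sum_pair_weight_le R [seq ((M 1 0 : int), (M 1 1 : int)) | M : SL2Z
  <- s].
rewrite big_map; apply; rewrite map_inj_in_uniq // => M N Ms Ns [ec ed].
by apply: (coset_reps_inj reps) => //; exact: sRep.
Qed.

End RowWeight.

(** * Domination of the summands for large weights *)

Section TermBound.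
Variables (R : realType) (t : nat) (m : 'I_t -> nat).
Local Notation p := (\sum_r m r)%N.
Variables (rho : SL2Z -> 'M[R[i]]_p) (mu : 'I_t -> R) (nu : 'I_t -> int).
Hypothesis rho_rep : is_representation rho.
Hypothesis rho_T : rho sl2_T = jordan_diag m (fun r => cexp2pi (mu r)%:C).

Lemma poincare_term_bound : exists K : nat, forall k : 'I_p -> int,
  (forall i, K%:Z <= k i) -> forall i j, exists C, 0 <= C /\
  forall (M : SL2Z) (tau : R[i]), fund_strip R tau -> M 1 0 != 0 ->
    normc (poincare_term rho mu nu k M tau i j) <= C * row_weight R M.
Proof.
have [CT [s [CT_ge0 rhoTz]]] := rho_Tz_growth rho_rep rho_T.
have [A [al [A_ge0 rhoA]]] := representation_growth rho_rep CT_ge0 rhoTz.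
(* Height 3 suffices, as the chosen representatives map the strip into the disc of radius 3. *)
have [CE [sE [CE_ge0 EC]]] := polybounded_mxnorm1
  (polybounded_equivariant_mx (m := m) mu nu 3).
(* With [q = |c| + |d|], the powers [s + al + s] pay for the growth of [rho M^-1], and the last 4
   leave the summable [q ^- 4]. *)
exists (s + al + s + 4)%N => k k_ge i j.
have [n kn n_ge] : exists2 n : nat, k j = n & (s + al + s + 4 <= n)%N.
  by have := k_ge j; case: (k j) => // n; exists n.
(* The factors bound [rho M^-1], the equivariant matrix (with [1 + |M tau| <= 4]) and the automorphy
   factor (at least [q / 2]); the 16 below comes from [row_weight_ge]. *)
pose C0 := A * 2 ^+ s * (CE * 4 ^+ sE) * 2 ^+ n.
have C0_ge0 : 0 <= C0 by rewrite !mulr_ge0 ?exprn_ge0.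
exists (C0 * 16); split=> [|M tau tauS c0]; first by rewrite mulr_ge0.
have nz := automorphy_neq0 M tauS.
have [l le_l] := nearest_multiple (M 0 0) c0.
(* Moving within the coset keeps the term and the lower row, and achieves [2 |a| <= |c|]. *)
rewrite -(poincare_term_coset nu rho_rep rho_T k (- l) i j nz).
pose M' := (sl2_Tz (- l) * M)%g; rewrite -/M'.
have M'c : M' 1 0 = M 1 0 by rewrite sl2_mulE !mxE /= mul0r add0r mul1r.
have M'd : M' 1 1 = M 1 1 by rewrite sl2_mulE !mxE /= mul0r add0r mul1r.
have M'a : (2 * `|(M' 0 0)%R| <= `|(M' 1 0)%R|)%N.
  by rewrite M'c sl2_mulE !mxE /= mul1r mulNr.
have -> : row_weight R M = row_weight R M' by rewrite /row_weight M'c M'd.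
have c'0 : M' 1 0 != 0 by rewrite M'c.
clearbody M'; clear l le_l M'c M'd M c0 nz; move: M' M'a c'0 => M M_a c0.
have nz := automorphy_neq0 M tauS.
rewrite poincare_termE // kn Normc.normcM Normc.normcV -exprnP normcX.
have := row_weight_ge R M; have := normc_automorphy_ge M tauS.
(* The inverse has first column [(d, -c)] and lower right entry [a], so [L = |c|] is admissible. *)
have := rhoA M^-1%g `|(M 1 0)%R|%N.
have [i00 i01 i10 i11] := sl2_invE M; rewrite i00 i10 i11 oppr_eq0 c0 absz_gt0
  c0 abszN.
move=> /(_ isT isT) /(_ (leq_trans (leq_pmull _ (isT : (0 < 2)%N)) M_a)).
have := EC (mobius M tau) _; have z3 := normc_mobius_le tauS c0 M_a.
move=> /(_ (le_trans (ler_Im_normc _) z3)) E_le rho_le a_ge w_ge.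
have := lower_row_gt0 M; move: rho_le a_ge w_ge; rewrite addnC.
set G := mxnorm1 _ in E_le; set N := mxnorm1 _.
move: (`|(M 1 0)%R|%N) (`|(M 1 1)%R|%N) => c d rho_le a_ge w_ge q_gt0.
have q1 : (1 : R) <= (c + d)%N%:R by rewrite ler1n.
have cq : (c%:R : R) <= (c + d)%N%:R by rewrite ler_nat leq_addr.
have c_ge0 : (0 : R) <= c%:R by [].
move: (_%N%:R) (c%:R) q1 cq c_ge0 rho_le a_ge w_ge.
move=> q c' q1 cq c_ge0 rho_le a_ge w_ge.
have q0 : 0 < q := lt_le_trans ltr01 q1.
have N_le : N <= A * 2 ^+ s * q ^+ (s + al + s).
  apply: le_trans rho_le _.
  have -> : A * 2 ^+ s * q ^+ (s + al + s) =
    A * q ^+ s * q ^+ al * (2 * q) ^+ s.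
    by rewrite exprMn !exprD; ring.
  have ? : 0 <= A * q ^+ s by rewrite mulr_ge0 // exprn_ge0 // ltW.
  apply: ler_pM.
  - by rewrite !mulr_ge0 ?exprn_ge0 // ltW.
  - by rewrite exprn_ge0 // addr_ge0.
  - by rewrite ler_wpM2l // lerXn2r ?nnegrE // ltW.
  have ? : 1 + c' <= 2 * q by lra.
  by rewrite lerXn2r ?nnegrE ?addr_ge0 // mulr_ge0 // ltW.
have G_le : G <= CE * 4 ^+ sE.
  apply: le_trans E_le _; rewrite ler_wpM2l //.
  by rewrite lerXn2r ?nnegrE ?addr_ge0 ?normc_ge0 //; lra.
have entry_le : normc ((rho M^-1%g *m equivariant_mx m mu nu (mobius M tau)) i
  j)
    <= A * 2 ^+ s * q ^+ (s + al + s) * (CE * 4 ^+ sE).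
  apply: le_trans (ler_mxnorm1 _ _ _) _; apply: le_trans (mxnorm1M _ _) _.
  by apply: ler_pM; rewrite ?mxnorm1_ge0.
have aut_le : (normc (automorphy M tau) ^+ n)^-1 <=
  2 ^+ n * q ^- (s + al + s + 4).
  have q2 : 0 < q / 2 by rewrite divr_gt0.
  apply: (@le_trans _ _ ((q / 2) ^- n)).
    rewrite lef_pV2 ?posrE ?exprn_gt0 ?(lt_le_trans q2) //.
    by rewrite lerXn2r ?nnegrE ?normc_ge0 // ltW.
  rewrite expr_div_n invf_div ler_wpM2l ?exprn_ge0 //.
  by rewrite lef_pV2 ?posrE ?exprn_gt0 // ler_weXn2l.
apply: (@le_trans _ _ (C0 * q ^- 4)); last first.
  by rewrite -[X in _ <= X]mulrA ler_wpM2l.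
apply: le_trans (ler_pM (normc_ge0 _) _ entry_le aut_le) _.
  by rewrite invr_ge0 exprn_ge0 // normc_ge0.
rewrite le_eqVlt; apply/orP; left; apply/eqP.
rewrite /C0 [q ^+ (_ + 4)]exprD invfM.
have : q ^+ (s + al + s) != 0 by rewrite expf_neq0 // gt_eqF.
have : q ^+ 4 != 0 by rewrite expf_neq0 // gt_eqF.
move: (q ^+ 4) (q ^+ (s + al + s)) => x y x0 y0.
by field; rewrite x0 y0.
Qed.

End TermBound.

(** * Absolute and uniform convergence of the Poincare series *)

Theorem theorem3p3 (R : realType) (t : nat) (m : 'I_t -> nat)
  (t_gt0 : (0 < t)%N) (m_gt0 : forall r, (0 < m r)%N)
  (rho : SL2Z -> 'M[R[i]]_(\sum_r m r)) (rho_rep : is_representation rho)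
  (lambda : 'I_t -> R[i]) (mu : 'I_t -> R)
  (rho_T : rho sl2_T = jordan_diag m lambda)
  (lambda_norm : forall r, `|lambda r| = 1)
  (lambda_mu : forall r, lambda r = cexp2pi (mu r)%:C)
  (nu : 'I_t -> int) :
  exists K : int, forall k : 'I_(\sum_r m r) -> int, (forall i, K <= k i) ->
  forall Rep : set SL2Z, coset_reps Rep ->
  forall i j : 'I_(\sum_r m r),
    (forall tau : R[i], fund_strip R tau ->
       summable Rep (fun M =>
         (Normc.normc (poincare_term rho mu nu k M tau i j))%:E)) /\
    {uniform fund_strip R,
      (fun (F : {fset Rep}) (tau : R[i]) =>
         poincare_partial rho mu nu k F tau i j : (R[i])^o)
        @ summability.totally -->
      (fun tau : R[i] => poincare rho mu nu k Rep tau i j : (R[i])^o)}.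
Proof.
have rho_T' : rho sl2_T = jordan_diag m (fun r => cexp2pi (mu r)%:C).
  by rewrite rho_T; congr jordan_diag; apply/funext.
have [K bound] := poincare_term_bound nu rho_rep rho_T'.
exists K => k k_ge Rep reps i j.
have [C [C_ge0 C_bound]] := bound k k_ge i j.
pose term M tau := poincare_term rho mu nu k M tau i j.
have pointwise tau : fund_strip R tau -> exists c,
    forall M, normc (term M tau) <= c * row_weight R M.
  move=> tauS; have nz N : automorphy N tau != 0 := automorphy_neq0 N tauS.
  pose e := normc (term 1%g tau); pose e' := normc (term (sl2_S * sl2_S)%g tau).
  have e_ge0 : 0 <= e := normc_ge0 _; have e'_ge0 : 0 <= e' := normc_ge0 _.
  (* If [c = 0], the term equals that of plus or minus the identity and the weight is 1/4, hence the
     factors 4. This constant depends on [tau]. *)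
  exists (C + 4 * e + 4 * e') => M.
  have w_ge0 := row_weight_ge0 R M.
  have [c0|c0] := eqVneq (M 1 0) 0; last first.
    apply: le_trans (C_bound M tau tauS c0) _; rewrite ler_wpM2r //; lra.
  rewrite row_weight_lower0 //; have [eM|eM] := sl2_lower0N c0.
    rewrite /term eM -[sl2_Tz _]mulg1 poincare_term_coset //
      -/(term 1%g tau) -/e; lra.
  rewrite /term eM poincare_term_coset // -/(term (sl2_S * sl2_S)%g tau) -/e';
    lra.
split=> [tau tauS|].
  have [c c_bound] := pointwise tau tauS.
  apply: (@summable_bounded _ _ _ _ (`|c| * 16)) => s us sRep.
  apply: (@le_trans _ _ (`|c| * \sum_(M <- s) row_weight R M)).
    rewrite mulr_sumr; apply: ler_sum => M _; rewrite ger0_norm ?normc_ge0 //.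
    apply: le_trans (c_bound M) _; rewrite ler_wpM2r ?row_weight_ge0 //.
    exact: ler_norm.
  by rewrite ler_wpM2l // (sum_row_weight_le _ reps).
pose f (x : Rep) tau : R[i] := 2^-1 * term (set_val x) tau.
have half : normc (2^-1 : R[i]) <= 1.
  have -> : 2^-1 = (2^-1 : R)%:C by rewrite fmorphV rmorphMn.
  by rewrite normc_real ger0_norm ?invf_le1 // ler1n.
have f_le x tau : normc (f x tau) <= normc (term (set_val x) tau).
  by rewrite Normc.normcM ler_piMl // normc_ge0.
have partialE (F : {fset Rep}) tau :
    poincare_partial rho mu nu k F tau i j = \sum_(x <- F) f x tau.
  by rewrite mxE summxE mulr_sumr.
have -> : (fun (F : {fset Rep}) (tau : R[i]) =>
    poincare_partial rho mu nu k F tau i j : (R[i])^o) =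
    (fun F tau => \sum_(x <- F) f x tau).
  by apply/funext => F; apply/funext => tau; exact: partialE.
have -> : (fun tau : R[i] => poincare rho mu nu k Rep tau i j : (R[i])^o) =
    (fun tau => lim ((fun F : {fset Rep} => \sum_(x <- F) f x tau : (R[i])^o)
      @ summability.totally)).
  apply/funext => tau; rewrite mxE.
  suff -> : (fun F : {fset Rep} =>
      poincare_partial rho mu nu k F tau i j : (R[i])^o) =
      (fun F => \sum_(x <- F) f x tau) by [].
  by apply/funext => F; exact: partialE.
apply: (@Mtest_uniform _ _ _ _ f (fun x => row_weight R (set_val x)) 16).
- by move=> x; exact: row_weight_ge0.
- move=> F; rewrite -(big_map set_val predT (row_weight R)).
  apply: (sum_row_weight_le _ reps).
    by rewrite map_inj_uniq ?fset_uniq //; exact: val_inj.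
  by move=> _ /mapP[x _ ->]; exact: set_valP.
- move=> tau /pointwise[c c_bound]; exists c => x.
  exact: le_trans (f_le x tau) (c_bound _).
(* A weight below 1/4 excludes [c = 0], so [C] works for every [tau] in the strip. *)
- exists C, 4^-1; split=> // x tau tauS lt_w; apply: le_trans (f_le x tau) _.
  apply: C_bound => //; apply/eqP => c0.
  by move: lt_w; rewrite row_weight_lower0 // ltxx.
Qed.
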